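(* (a) For $x,z\in W$, one has $$xRz\iff\bigl(x\vee z=zx\text{ and }\Phi_x\cap\Phi_z=\emptyset\bigr)\iff\Phi_{zx}=\Phi_z\,\dot\cup\,\Phi_x .$$ (b) If $xRz$ then $xRz^{-1}$ and $l(zx)=l(z)+l(x)$. (c) The elements of $\mathcal{W}_\dagger$ are subgroups of $W$. (d) The elements of $\mathcal{W}_*$ are complete meet subsemilattices of $(W,\leq)$ with $1_W$ as minimum element. (e) If $L\in\mathcal{W}_*$, then for any subset $X$ of $L$ which has an upper bound in $W$, its join $x:=\bigvee X$ in $W$ is an element of $L$ (and so $x$ is the least upper bound of $X$ in $L$).
   Context: Setting: $V$ is a real vector space with a symmetric bilinear form $\langle\cdot,\cdot\rangle$ and $\Pi\subseteq V$ is a set (the simple roots, possibly infinite) such that (i) $\Pi$ is positively independent (if a finite sum $\sum_{\alpha\in\Pi}c_\alpha\alpha=0$ with all $c_\alpha\geq 0$, then all $c_\alpha=0$); (ii) $\langle\alpha,\alpha\rangle=1$ for $\alpha\in\Pi$, and $\langle\alpha,\beta\rangle\in\{-\cos(\pi/m)\mid m\in\mathbb{Z}_{\geq 2}\}\cup(-\infty,-1]$ for distinct $\alpha,\beta\in\Pi$. For $\alpha\in V$ with $\langle\alpha,\alpha\rangle=1$, let $s_\alpha(v)=v-2\langle v,\alpha\rangle\alpha$. Then $S=\{s_\alpha\mid\alpha\in\Pi\}$, $W=\langle S\rangle$ is a Coxeter group with Coxeter system $(W,S)$ and length function $l$. The root system is $\Phi=W\Pi$; the positive roots $\Phi_+$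 are the roots that are non-negative real linear combinations of $\Pi$; $\Phi_-=-\Phi_+$, and $\Phi$ is the disjoint union of $\Phi_+$ and $\Phi_-$. For $z\in W$, $\Phi_z:=\Phi_+\cap z(\Phi_-)$. The weak (right) order on $W$ is defined by $x\leq y$ iff $l(y)=l(x)+l(x^{-1}y)$ (equivalently $\Phi_x\subseteq\Phi_y$). In this order $W$ is a complete meet semilattice (every non-empty subset has a greatest lower bound), and every subset with an upper bound has a least upper bound; $\vee,\bigvee$ denote joins, and ''$x\vee z=zx$'' includes the assertion that $x\vee z$ exists. A complete meet subsemilattice of $(W,\leq)$ is a subset $X$ of $W$ such that for any non-empty $Y\subseteq X$, the meet $\bigwedge Y$ in $W$ lies in $X$. The symbol $\dot\cup$ indicates a union of disjoint sets. Define a relation $R$ on $W$ by $xRz$ iff $z(\Phi_x)=\Phi_x$. For $X,Z\subseteq W$ let $X^\dagger:=\{z\in W\mid xRz\text{ for all }x\in X\}$ and $Z^*:=\{x\in W\mid xRz\text{ for all }z\in Z\}$. Let $\mathcal{W}_*:=\{Z^*\mid Z\subseteq W\}$ and $\mathcal{W}_\dagger:=\{X^\dagger\mid X\subseteq W\}$ (equivalently the subsets $L$ with $L^{\dagger*}=L$, respectively the subsets $G$ with $G^{*\dagger}=G$). *)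

(* Defs.v *)
From HB Require Import structures.
From mathcomp Require Import all_boot all_order all_algebra finmap.
From mathcomp Require Import boolp classical_sets reals interval_inference.
From mathcomp Require Import topology normedtype sequences trigo.

Set Implicit Arguments.
Unset Strict Implicit.
Unset Printing Implicit Defensive.

Import Order.TTheory GRing.Theory Num.Theory.

Local Open Scope classical_set_scope.
Local Open Scope ring_scope.

Section SimpleRoots.
Context (R : realType) (V : lmodType R).

Definition positively_independent (P : set V) : Prop :=
  forall (F : {fset V}) (c : V -> R),
    [set` F] `<=` P -> {in F, forall a, 0 <= c a} ->
    \sum_(a <- F) c a *: a = 0 -> {in F, forall a, c a = 0}.

Definition nonneg_span (P : set V) : set V :=
  [set v | exists (F : {fset V}) (c : V -> R),
    [/\ [set` F] `<=` P, {in F, forall a, 0 <= c a}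
      & v = \sum_(a <- F) c a *: a]].

Record simple_system := SimpleSystem {
  bform : {symmetric V};
  simple_root : set V;
  simple_pos_indep : positively_independent simple_root;
  simple_norm1 : forall a, simple_root a -> bform a a = 1;
  simple_form : forall a b, simple_root a -> simple_root b -> a <> b ->
    (exists2 m : nat, (2 <= m)%N & bform a b = - cos (pi / m%:R)) \/
    bform a b <= -1
}.

Definition refl (D : simple_system) (a v : V) : V :=
  v - (2 * bform D v a) *: a.

(* The composite s_(a_1) \o ... \o s_(a_n) for s = [:: a_1; ...; a_n]. *)
Definition refl_word (D : simple_system) (s : seq V) : V -> V :=
  foldr (fun a f => refl D a \o f) id s.

(* The generators are involutions, so the group they generate consists of the
   words in the generators, without formal inverses. *)
Record weyl (D : simple_system) := Weyl {
  weyl_fun :> V -> V;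
  weyl_funP :
    exists2 s : seq V, [set` s] `<=` simple_root D & weyl_fun = refl_word D s
}.

HB.instance Definition _ D := gen_eqMixin (weyl D).
HB.instance Definition _ D := gen_choiceMixin (weyl D).

End SimpleRoots.

Section WeylGroup.
Context (R : realType) (V : lmodType R) (D : simple_system V).
Implicit Types (x y z w : weyl D) (s t : seq V).

Lemma weyl_inj x y : x = y :> (V -> V) -> x = y.
Proof.
by case: x y => [f Hf] [g Hg] /= fg; subst g; rewrite (Prop_irrelevance Hf Hg).
Qed.

Lemma refl_word_cat s t :
  refl_word D (s ++ t) = refl_word D s \o refl_word D t.
Proof. by elim: s => //= a s ->. Qed.

Lemma reflK a : simple_root D a -> involutive (refl D a).
Proof.
move=> /simple_norm1 a1 v; rewrite /refl linearBl linearZl_LR /= a1 mulr1.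
rewrite -addrA -opprD -scalerDl -mulrDr.
set c := bform D v a.
by rewrite [2 * c]mulr_natl mulr2n addrA subrr mulr0 scale0r subr0.
Qed.

Lemma refl_word_rev s : [set` s] `<=` simple_root D ->
  cancel (refl_word D s) (refl_word D (rev s)).
Proof.
elim: s => [|a s IHs] // sub v.
rewrite rev_cons -cats1 refl_word_cat /= reflK; last first.
  by apply: sub; rewrite /= inE eqxx.
by apply: IHs => b bs; apply: sub; rewrite /= inE bs orbT.
Qed.

Lemma weyl_one_subproof :
  exists2 s, [set` s] `<=` simple_root D & id = refl_word D s.
Proof. by exists [::]. Qed.

Definition weyl_one : weyl D := Weyl weyl_one_subproof.

Lemma weyl_mul_subproof x y :
  exists2 s, [set` s] `<=` simple_root D & x \o y = refl_word D s.
Proof.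
have [s sD xs] := weyl_funP x; have [t tD yt] := weyl_funP y; exists (s ++ t).
  by move=> a /=; rewrite mem_cat => /orP[/sD|/tD].
by rewrite refl_word_cat xs yt.
Qed.

Definition weyl_mul x y : weyl D := Weyl (weyl_mul_subproof x y).

Lemma weyl_inv_subproof x :
  exists2 s, [set` s] `<=` simple_root D &
    refl_word D (rev (s2val (cid2 (weyl_funP x)))) = refl_word D s.
Proof.
case: cid2 => /= s sD _; exists (rev s) => //.
by move=> a /=; rewrite mem_rev => /sD.
Qed.

Definition weyl_inv x : weyl D := Weyl (weyl_inv_subproof x).

Lemma weyl_mulA : associative weyl_mul.
Proof. by move=> x y z; apply: weyl_inj. Qed.

Lemma weyl_mul1 : left_id weyl_one weyl_mul.
Proof. by move=> x; apply: weyl_inj. Qed.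

Lemma weyl_mulr1 : right_id weyl_one weyl_mul.
Proof. by move=> x; apply: weyl_inj. Qed.

Lemma weyl_mulV : left_inverse weyl_one weyl_inv weyl_mul.
Proof.
move=> x; apply: weyl_inj; apply: funext => v /=.
by case: cid2 => /= s sD ->; rewrite refl_word_rev.
Qed.

Lemma weyl_mulrV : right_inverse weyl_one weyl_inv weyl_mul.
Proof.
move=> x; apply: weyl_inj; apply: funext => v /=.
case: cid2 => /= s sD ->.
have sD' : [set` rev s] `<=` simple_root D.
  by move=> a /=; rewrite mem_rev => /sD.
by have := refl_word_rev sD' v; rewrite revK.
Qed.

HB.instance Definition _ := isGroup.Build (weyl D)
  weyl_mulA weyl_mul1 weyl_mulr1 weyl_mulV weyl_mulrV.

Definition simple_word_of_size w (n : nat) : Prop :=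
  exists s, [/\ [set` s] `<=` simple_root D, size s = n
    & w = refl_word D s :> (V -> V)].

Lemma weyl_length_subproof w : exists n, `[< simple_word_of_size w n >].
Proof.
by case: (weyl_funP w) => s sD ws; exists (size s); apply/asboolP; exists s.
Qed.

Definition weyl_length w : nat := ex_minn (weyl_length_subproof w).

Lemma weyl_lengthP w : exists s, [/\ [set` s] `<=` simple_root D,
  size s = weyl_length w & w = refl_word D s :> (V -> V)].
Proof. by rewrite /weyl_length; case: ex_minnP => n /asboolP. Qed.

Lemma weyl_length_min w s : [set` s] `<=` simple_root D ->
  w = refl_word D s :> (V -> V) -> (weyl_length w <= size s)%N.
Proof.
move=> sD ws; rewrite /weyl_length; case: ex_minnP => n _; apply.
by apply/asboolP; exists s.
Qed.

Lemma weyl_length1 : weyl_length 1%g = 0%N.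
Proof.
by apply/eqP; rewrite -leqn0; apply: (@weyl_length_min _ [::]).
Qed.

Lemma weyl_length_eq0 w : weyl_length w = 0%N -> w = 1%g.
Proof.
case: (weyl_lengthP w) => s [_ <- ws] /size0nil s0.
by apply: weyl_inj; rewrite ws s0.
Qed.

Lemma weyl_lengthM x y :
  (weyl_length (x * y)%g <= weyl_length x + weyl_length y)%N.
Proof.
case: (weyl_lengthP x) (weyl_lengthP y) => s [sD <- xs] [t [tD <- yt]].
rewrite -size_cat; apply: weyl_length_min.
  by move=> a /=; rewrite mem_cat => /orP[/sD|/tD].
by rewrite refl_word_cat -xs -yt.
Qed.

Definition weak_le x y : bool :=
  weyl_length y == (weyl_length x + weyl_length (x^-1 * y)%g)%N.

Lemma weak_le_refl : reflexive weak_le.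
Proof. by move=> x; rewrite /weak_le mulVg weyl_length1 addn0. Qed.

Lemma weak_le_anti : antisymmetric weak_le.
Proof.
move=> x y /andP[/eqP xy /eqP]; rewrite xy -addnA => /eqP.
rewrite -{1}[weyl_length x]addn0 eqn_add2l eq_sym addn_eq0.
by move=> /andP[/eqP/weyl_length_eq0 xy1 _]; rewrite -(mulVKg x y) xy1 mulg1.
Qed.

Lemma weak_le_trans : transitive weak_le.
Proof.
move=> y x z /eqP xy /eqP yz; rewrite /weak_le eqn_leq; apply/andP; split.
  by have := weyl_lengthM x (x^-1 * z)%g; rewrite mulVKg.
rewrite yz xy -addnA leq_add2l.
by have := weyl_lengthM (x^-1 * y)%g (y^-1 * z)%g; rewrite mulgA mulgK.
Qed.

Fact weak_display : Order.disp_t. Proof. exact: Order.Disp tt tt. Qed.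

HB.instance Definition _ := Order.Le_isPOrder.Build weak_display (weyl D)
  weak_le_refl weak_le_anti weak_le_trans.

End WeylGroup.

Section RootsAndGalois.
Context (R : realType) (V : lmodType R) (D : simple_system V).
Implicit Types (x z : weyl D) (X Z L G : set (weyl D)).

Definition root_system : set V :=
  \bigcup_(w in [set: weyl D]) w @` simple_root D.

Definition pos_roots : set V := root_system `&` nonneg_span (simple_root D).

Definition neg_roots : set V := -%R @` pos_roots.

Definition inversions z : set V := pos_roots `&` z @` neg_roots.

(* The relation x R z. *)
Definition stab_rel x z : Prop := z @` inversions x = inversions x.

Definition dagger X : set (weyl D) := [set z | forall x, X x -> stab_rel x z].

Definition star Z : set (weyl D) := [set x | forall z, Z z -> stab_rel x z].

Definition W_star : set (set (weyl D)) := range star.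

Definition W_dagger : set (set (weyl D)) := range dagger.

Definition is_subgroup G : Prop :=
  [/\ G 1%g, forall x y, G x -> G y -> G (x * y)%g
    & forall x, G x -> G x^-1%g].

(* The meet m is taken in the whole group, and its existence is part of the
   requirement. *)
Definition complete_meet_subsemilattice L : Prop :=
  forall Y, Y !=set0 -> Y `<=` L -> exists2 m, infimums Y m & L m.

End RootsAndGalois.

(* Main.v *)
Require Import Defs.
From HB Require Import structures.
From mathcomp Require Import all_boot all_order all_algebra.
From mathcomp Require Import boolp classical_sets reals.
From mathcomp Require Import finmap cardinality trigo ring lra.

Set Implicit Arguments.
Unset Strict Implicit.
Unset Printing Implicit Defensive.

Import Order.TTheory GRing.Theory Num.Theory.

Local Open Scope classical_set_scope.
Local Open Scope ring_scope.

(** The proof rests on a dictionary between the weak order and root geometry: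
  [x <= y] holds exactly when [inversions x] is contained in [inversions y]
  ([weak_leP]).  Its source is the fact that [w a] is a non-negative combination
  of simple roots as soon as multiplying [w] by the reflection in the simple root
  [a] on the right does not decrease the length ([positive_of_length]).  This is
  an induction on length that reduces to the dihedral group of two simple roots,
  where the coefficients of [w a] are values of Chebyshev polynomials; for an
  angle pi / m they are non-negative up to step m, and beyond that the braid
  relation shortens the word ([pair_exchange]).  Positive independence of the
  simple roots enters only through two facts: the positive cone is salient, and
  each simple root spans an extremal ray of it.

  Two elements with an upper bound have a join, and the inversion set of the join
  lies in the convex cone spanned by the inversion sets of the two elements
  ([pair_join]).  This extends to arbitrary bounded families ([bounded_join]), and
  the meet of a non-empty family is the join of its lower bounds.

  If [z] permutes [inversions x], then it sends these roots to positive roots, so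
  [z <= z * x], and [inversions (z * x)] is the disjoint union of [inversions z]
  and [z @` inversions x], which is [inversions x].  Conversely, if [z * x] is
  above [x] and [z] and the two inversion sets are disjoint, then [z^-1] maps the
  finite set [inversions x] into itself, hence onto itself.

  For the closure properties, let [z] permute [inversions y] for all [y] in some
  family.  If [m] is the meet of the family, then left multiplication by [z]
  carries [m] to the meet of the [z * y]; as [m <= y <= z * y], this gives
  [m <= z * m], and the inversions of [m] are not inversions of [z], so [z^-1]
  maps [inversions m] into itself.  If [x] is the join, then [z * x] is an upper
  bound of the family, so [x <= z * x], and [z^-1] keeps [inversions x] positive
  because this set lies in the cone spanned by the sets [inversions y].  In both
  cases the same argument with [z^-1] in place of [z] gives equality. *)

(** * Cones *)

Section Cones.
Context (R : realType) (V : lmodType R).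
Implicit Types (P Q : set V) (u v w : V).

Lemma sum_fset_extend (F G : {fset V}) (c : V -> R) : (F `<=` G)%fset ->
  \sum_(a <- F) c a *: a = \sum_(a <- G) (if a \in F then c a else 0) *: a.
Proof.
move=> FG; rewrite -[RHS](big_fset_incl _ FG) => [|a _ /negbTE ->].
  by rewrite big_seq [RHS]big_seq; apply: eq_bigr => a ->.
by rewrite scale0r.
Qed.

Lemma sum_fset_add (F G : {fset V}) (c d : V -> R) :
  \sum_(a <- F) c a *: a + \sum_(a <- G) d a *: a =
  \sum_(a <- (F `|` G)%fset)
    ((if a \in F then c a else 0) + (if a \in G then d a else 0)) *: a.
Proof.
rewrite (sum_fset_extend c (fsubsetUl F G)) (sum_fset_extend d (fsubsetUr F G)).
by rewrite -big_split; apply: eq_bigr => a _; rewrite scalerDl.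
Qed.

Lemma coef_add_ge0 (F G : {fset V}) (c d : V -> R) :
  {in F, forall a, 0 <= c a} -> {in G, forall a, 0 <= d a} ->
  forall a, 0 <= (if a \in F then c a else 0) + (if a \in G then d a else 0).
Proof. by move=> c0 d0 a; apply: addr_ge0; case: ifP => // /[dup]; auto. Qed.

Lemma fsetU_sub (F G : {fset V}) P :
  [set` F] `<=` P -> [set` G] `<=` P -> [set` (F `|` G)%fset] `<=` P.
Proof. by move=> FP GP a /=; rewrite in_fsetU => /orP[/FP|/GP]. Qed.

Lemma nonneg_span0 P : nonneg_span P 0.
Proof.
by exists fset0, (fun=> 0); split => //; rewrite big_seq_fset0.
Qed.

Lemma nonneg_spanD P u v :
  nonneg_span P u -> nonneg_span P v -> nonneg_span P (u + v).
Proof.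
move=> [F [c [FP c0 ->]]] [G [d [GP d0 ->]]].
rewrite sum_fset_add; eexists; eexists; split; last reflexivity.
  exact: fsetU_sub.
by move=> a _; apply: coef_add_ge0.
Qed.

Lemma nonneg_spanZ P k v :
  0 <= k -> nonneg_span P v -> nonneg_span P (k *: v).
Proof.
move=> k0 [F [c [FP c0 ->]]]; exists F, (fun a => k * c a); split => //.
  by move=> a aF; rewrite mulr_ge0 ?c0.
by rewrite scaler_sumr; apply: eq_bigr => a _; rewrite scalerA.
Qed.

Lemma sub_nonneg_span P : P `<=` nonneg_span P.
Proof.
move=> a Pa; exists [fset a]%fset, (fun=> 1); split => //.
  by move=> b /=; rewrite in_fset1 => /eqP ->.
by rewrite big_seq_fset1 scale1r.
Qed.

Lemma nonneg_span_ind P Q : Q 0 -> (forall u v, Q u -> Q v -> Q (u + v)) ->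
  (forall k v, 0 <= k -> Q v -> Q (k *: v)) -> P `<=` Q ->
  nonneg_span P `<=` Q.
Proof.
move=> Q0 QD QZ PQ v [F [c [FP c0 ->]]].
rewrite big_seq; elim/big_ind: _ => // a aF.
by apply: QZ; [apply: c0|apply/PQ/FP].
Qed.

Lemma nonneg_span_sub P Q : P `<=` nonneg_span Q ->
  nonneg_span P `<=` nonneg_span Q.
Proof.
apply: nonneg_span_ind => [|u v|k v]; first exact: nonneg_span0.
  exact: nonneg_spanD.
exact: nonneg_spanZ.
Qed.

(** Adding the two representations gives a vanishing non-negative combination, so
  all its coefficients vanish. *)
Lemma nonneg_span_salient P v : positively_independent P ->
  nonneg_span P v -> nonneg_span P (- v) -> v = 0.
Proof.
move=> indep [F [c [FP c0 vF]]] [G [d [GP d0 vG]]].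
have /eqP := subrr v; rewrite {1}vF vG sum_fset_add => /eqP.
move=> /(indep _ _ (fsetU_sub FP GP) (fun a _ => coef_add_ge0 c0 d0 a)) s0.
rewrite vF big_seq; apply: big1 => a aF.
have := s0 a; rewrite in_fsetU aF => /(_ isT) /eqP.
have ca := c0 a aF.
rewrite paddr_eq0 //; last by case: ifP => // /d0.
by move=> /andP[/eqP -> _]; rewrite scale0r.
Qed.

End Cones.

(** * Simple roots and reflections *)

Section Reflections.
Context (R : realType) (V : lmodType R) (D : simple_system V).
Implicit Types (u v : V) (k : R) (w x y z : weyl D) (s t : seq V).

Local Notation "''[' u , v ]" := (bform D u v).
Local Notation simple := (simple_root D).
Local Notation positive := (nonneg_span (simple_root D)).

Lemma bformC u v : '[u, v] = '[v, u].
Proof. by rewrite hermC /= expr0 mul1r. Qed.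

Lemma simple_form_le0 a b : simple a -> simple b -> a <> b -> '[a, b] <= 0.
Proof.
move=> sa sb /(simple_form sa sb) [[m m2 ->]|]; last first.
  by move=> /le_trans; apply; lra.
rewrite oppr_le0; apply: cos_ge0_pihalf; have p0 := pi_gt0 R.
have m0 : (0 < m%:R :> R) by rewrite ltr0n; apply: leq_trans m2.
apply/andP; split; first by rewrite (@le_trans _ _ 0) ?divr_ge0 ?ltW //; lra.
by rewrite ler_pM2l // lef_pV2 ?posrE // ler_nat.
Qed.

Lemma positive_salient v : positive v -> positive (- v) -> v = 0.
Proof. exact: nonneg_span_salient (@simple_pos_indep _ _ D). Qed.

(** The coefficient of [a] is separated from the rest of the combination, which
  pairs non-positively with [a] because distinct simple roots do. *)
Lemma positive_split a v : simple a -> positive v ->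
  exists c v', [/\ 0 <= c, positive v', '[v', a] <= 0 & v = c *: a + v'].
Proof.
move=> sa.
apply: (@nonneg_span_ind _ _ _ [set v | exists c v',
  [/\ 0 <= c, positive v', '[v', a] <= 0 & v = c *: a + v']]).
- exists 0, 0; split => //; first exact: nonneg_span0.
    by rewrite linear0l.
  by rewrite scale0r addr0.
- move=> _ _ [c [v' [c0 v'P v'a ->]]] [d [u' [d0 u'P u'a ->]]].
  exists (c + d), (v' + u'); split; first exact: addr_ge0.
  - exact: nonneg_spanD.
  - by rewrite linearDl; lra.
  - by rewrite scalerDl addrACA.
- move=> k _ k0 [c [v' [c0 v'P v'a ->]]].
  exists (k * c), (k *: v'); split; first exact: mulr_ge0.
  - exact: nonneg_spanZ.
  - by rewrite linearZl_LR /=; nra.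
  - by rewrite scalerDr scalerA.
- move=> b sb; have [->|/eqP ab] := eqVneq b a.
    exists 1, 0; split => //; first exact: nonneg_span0.
      by rewrite linear0l.
    by rewrite scale1r addr0.
  exists 0, b; split => //; first exact: sub_nonneg_span.
    exact: simple_form_le0.
  by rewrite scale0r add0r.
Qed.

(** A simple root spans an extremal ray of the positive cone.  Pairing with [a]
  shows that a positive multiple of [a] is not a non-negative combination of the
  other simple roots, and salience settles the remaining case.  This replaces
  comparison of coefficients, which is unavailable since simple roots may be
  linearly dependent. *)
Lemma simple_extremal a k u v : simple a -> positive u -> positive v ->
  u + v = k *: a -> exists2 c, 0 <= c & u = c *: a.
Proof.
move=> sa /(positive_split sa)[c [u' [c0 u'P u'a ->]]].
move=> /(positive_split sa)[d [v' [d0 v'P v'a ->]]].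
rewrite addrACA -scalerDl => E.
have E' : u' + v' = (k - (c + d)) *: a.
  by apply: (addrI ((c + d) *: a)); rewrite E -scalerDl addrC subrK.
have kle : k - (c + d) <= 0.
  have := congr1 (fun e : V => '[e, a]) E'.
  rewrite /= linearDl linearZl_LR /= simple_norm1 // mulr1 => <-; lra.
exists c => //; rewrite (_ : u' = 0) ?addr0 //; apply: positive_salient => //.
rewrite (_ : - u' = v' + (- (k - (c + d))) *: a).
  apply: nonneg_spanD => //; apply: nonneg_spanZ; first by rewrite oppr_ge0.
  exact: sub_nonneg_span.
by rewrite scaleNr -E' opprD addrCA subrr addr0.
Qed.

Lemma refl_is_linear a : linear (refl D a).
Proof.
move=> k u v; rewrite /refl linearPl /= scalerBr scalerA.
rewrite mulrDr scalerDl opprD addrACA; congr (_ - _ + _).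
by congr (_ *: _); rewrite mulrCA.
Qed.

Lemma refl_isometry a u v : simple a -> '[refl D a u, refl D a v] = '[u, v].
Proof.
move=> /simple_norm1 a1; rewrite /refl !(linearBl, linearBr) /=.
rewrite !(linearZl_LR, linearZr_LR) /= a1 (bformC a v) mulr1; ring.
Qed.

Lemma refl_self a : simple a -> refl D a a = - a.
Proof.
move=> /simple_norm1 a1; rewrite /refl a1 mulr1 scaler_nat mulr2n opprD.
by rewrite addrA subrr sub0r.
Qed.

Lemma refl_word_linear s : linear (refl_word D s).
Proof.
elim: s => [|a s IHs] k u v //=.
by rewrite IHs refl_is_linear.
Qed.

Lemma refl_wordN s v : refl_word D s (- v) = - refl_word D s v.
Proof.
have f0 : refl_word D s 0 = 0.
  have := refl_word_linear s 1 0 0; rewrite !scale1r !addr0 => E.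
  by apply: (addrI (refl_word D s 0)); rewrite -E addr0.
by have := refl_word_linear s (-1) v 0; rewrite f0 !addr0 !scaleN1r.
Qed.

Lemma refl_word_isometry s u v : [set` s] `<=` simple ->
  '[refl_word D s u, refl_word D s v] = '[u, v].
Proof.
elim: s => [|a s IHs] //= sP; rewrite refl_isometry ?IHs //.
  by move=> b bs; apply: sP; rewrite /= inE bs orbT.
by apply: sP; rewrite /= inE eqxx.
Qed.

Lemma weyl_linear w : linear (w : V -> V).
Proof. by case: (weyl_funP w) => s _ -> ; apply: refl_word_linear. Qed.

Lemma weylD w u v : w (u + v) = w u + w v.
Proof. by have := weyl_linear w 1 u v; rewrite !scale1r. Qed.

Lemma weyl0 w : w 0 = 0.
Proof. by apply: (addrI (w 0)); rewrite -weylD !addr0. Qed.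

Lemma weylZ w k v : w (k *: v) = k *: w v.
Proof. by have := weyl_linear w k v 0; rewrite !addr0 weyl0 addr0. Qed.

Lemma weylN w v : w (- v) = - w v.
Proof. by rewrite -scaleN1r weylZ scaleN1r. Qed.

Lemma weyl_isometry w u v : '[w u, w v] = '[u, v].
Proof. by case: (weyl_funP w) => s sP ->; apply: refl_word_isometry. Qed.

Lemma weylM x y v : (x * y)%g v = x (y v).
Proof. by []. Qed.

Lemma weyl1 v : (1%g : weyl D) v = v.
Proof. by []. Qed.

Lemma weylK w : cancel w (w^-1)%g.
Proof. by move=> v; rewrite -weylM mulVg weyl1. Qed.

Lemma weylVK w : cancel (w^-1)%g w.
Proof. by move=> v; rewrite -weylM mulgV weyl1. Qed.

Lemma weyl_of_word t : [set` t] `<=` simple ->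
  exists w, w = refl_word D t :> (V -> V).
Proof.
move=> tP.
have H : exists2 s, [set` s] `<=` simple & refl_word D t = refl_word D s.
  by exists t.
by exists (Weyl H).
Qed.

End Reflections.

(** * Rank two *)

Section RankTwo.
Context (R : realType) (V : lmodType R) (D : simple_system V).
Implicit Types (u v : V) (w x y z : weyl D) (s t : seq V) (k m : nat).

Local Notation "''[' u , v ]" := (bform D u v).
Local Notation simple := (simple_root D).
Local Notation positive := (nonneg_span (simple_root D)).

(** Chebyshev polynomials of the second kind, shifted so that at [2 * cos th] the
  value of index [k] is [sin (k * th) / sin th]. *)
Fixpoint chebyshev (q : R) k : R :=
  match k with
  | 0 => 0
  | k'.+1 => match k' with
             | 0 => 1
             | k''.+1 => q * chebyshev q k' - chebyshev q k''
             end
  end.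

Lemma chebyshevSS q k :
  chebyshev q k.+2 = q * chebyshev q k.+1 - chebyshev q k.
Proof. by []. Qed.

Lemma chebyshev_ge0 q k : 2 <= q -> 0 <= chebyshev q k.
Proof.
move=> q2; suff /andP[] : (0 <= chebyshev q k <= chebyshev q k.+1) by [].
elim: k => [|k /andP[IH0 IH1]]; first by rewrite lexx ler01.
rewrite chebyshevSS; apply/andP; split; first exact: le_trans IH1.
nra.
Qed.

Lemma chebyshev_sin (th : R) k :
  chebyshev (2 * cos th) k * sin th = sin (k%:R * th).
Proof.
suff [] : chebyshev (2 * cos th) k * sin th = sin (k%:R * th) /\
  chebyshev (2 * cos th) k.+1 * sin th = sin (k.+1%:R * th) by [].
elim: k => [|k [IH0 IH1]]; first by rewrite !mul0r sin0 !mul1r.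
split => //; rewrite chebyshevSS mulrBl IH0 -[_ * _ * sin th]mulrA IH1.
rewrite (_ : k.+2%:R * th = k.+1%:R * th + th); last by rewrite -natr1; ring.
rewrite (_ : k%:R * th = k.+1%:R * th - th); last by rewrite -[k.+1%:R]natr1; ring.
rewrite sinB sinD; ring.
Qed.

Section ChebyshevAngle.
Variables (m : nat) (m2 : (2 <= m)%N).
Let th : R := pi / m%:R.
Let q := 2 * cos th.

Lemma sin_pi_div_gt0 : 0 < sin th.
Proof.
have p0 := pi_gt0 R; have m0 : (1 < m%:R :> R) by rewrite ltr1n.
apply: sin_gt0_pi; rewrite divr_gt0 //=; last by lra.
by rewrite ltr_pdivrMr; [nra|lra].
Qed.

Let mth : m%:R * th = pi.
Proof. by rewrite mulrC divfK // pnatr_eq0; case: m m2. Qed.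

Lemma chebyshev_angle_ge0 k : (k <= m)%N -> 0 <= chebyshev q k.
Proof.
move=> km; have s0 := sin_pi_div_gt0.
rewrite -(pmulr_lge0 _ s0) chebyshev_sin; apply: sin_ge0_pi.
have th0 : 0 <= th by rewrite divr_ge0 // ltW // pi_gt0.
by rewrite mulr_ge0 //= -mth ler_wpM2r // ler_nat.
Qed.

Lemma chebyshev_angle_m : chebyshev q m = 0.
Proof.
have s0 := sin_pi_div_gt0.
by apply: (mulIf (lt0r_neq0 s0)); rewrite chebyshev_sin mth sinpi mul0r.
Qed.

Lemma chebyshev_angle_mS : chebyshev q m.+1 = -1.
Proof.
have s0 := sin_pi_div_gt0.
apply: (mulIf (lt0r_neq0 s0)); rewrite chebyshev_sin.
by rewrite -natr1 mulrDl mul1r mth addrC sinDpi mulN1r.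
Qed.

Lemma chebyshev_angle_pred : chebyshev q m.-1 = 1.
Proof.
have := chebyshevSS q m.-1; rewrite !(ltn_predK m2).
rewrite chebyshev_angle_m chebyshev_angle_mS; lra.
Qed.

End ChebyshevAngle.

(** The last letter, which acts first, is [b]. *)
Fixpoint alternating (a b : V) k : seq V :=
  if k is k'.+1 then rcons (alternating b a k') b else [::].

Lemma size_alternating a b k : size (alternating a b k) = k.
Proof. by elim: k a b => //= k IHk a b; rewrite size_rcons IHk. Qed.

Lemma alternating_sub a b k : all (pred2 a b) (alternating a b k).
Proof.
elim: k a b => //= k IHk a b; rewrite all_rcons /= eqxx orbT /=.
by apply: sub_all (IHk b a) => c /=; rewrite orbC.
Qed.

Lemma alternating_split a b k m : (m <= k)%N ->
  exists2 p, all (pred2 a b) p & alternating a b k = p ++ alternating a b m.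
Proof.
elim: m k a b => [|m IHm] k a b.
  by exists (alternating a b k); [exact: alternating_sub|rewrite cats0].
case: k => // k /(IHm k b a)[p pab /= ->].
exists p; last by rewrite rcons_cat.
by apply: sub_all pab => c /=; rewrite orbC.
Qed.

Lemma pair_word_simple a b t : simple a -> simple b -> all (pred2 a b) t ->
  [set` t] `<=` simple.
Proof. by move=> sa sb /allP tab c /tab /orP[/eqP ->|/eqP ->]. Qed.

Lemma refl_word_rcons s a v :
  refl_word D (rcons s a) v = refl_word D s (refl D a v).
Proof. by rewrite -cats1 refl_word_cat. Qed.

Lemma refl_word_pair a b t v : all (pred2 a b) t ->
  exists x y : R, refl_word D t v = v + (x *: a + y *: b).
Proof.
elim: t => [|c t IHt] /=.
  by exists 0, 0; rewrite !scale0r !addr0.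
move=> /andP[cab /IHt[x [y ->]]]; rewrite /refl.
set e := 2 * _; case/orP: cab => /eqP ->.
  by exists (x - e), y; rewrite scalerBl -addrA; congr (v + _); rewrite addrAC.
by exists x, (y - e); rewrite scalerBl -!addrA.
Qed.

(** With this parameter the Chebyshev recurrence describes the dihedral action; it
  is [2 * cos th] when the angle between the mirrors is [th]. *)
Definition pair_coef (a b : V) : R := - (2 * '[a, b]).

Lemma pair_coefC a b : pair_coef a b = pair_coef b a.
Proof. by rewrite /pair_coef bformC. Qed.

Lemma refl_pair a b (x y : R) : simple b ->
  refl D b (x *: a + y *: b) = x *: a + (pair_coef a b * x - y) *: b.
Proof.
move=> /simple_norm1 b1; rewrite /refl linearDl !linearZl_LR /= b1 mulr1.
rewrite -addrA -scalerBl; congr (_ + _ *: _); rewrite /pair_coef; ring.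
Qed.

(** Each reflection advances the index of one of the two coefficients by two, so
  the pair of consecutive Chebyshev values moves up by one. *)
Lemma alternating_action a b k j : simple a -> simple b ->
  let S := chebyshev (pair_coef a b) in
  refl_word D (alternating a b k) (S j.+1 *: a + S j *: b) =
  S (j + k).+1 *: (if odd k then b else a) +
  S (j + k)%N *: (if odd k then a else b).
Proof.
elim: k a b j => [|k IHk] a b j sa sb S; first by rewrite /= addn0.
rewrite /= refl_word_rcons refl_pair // -chebyshevSS addrC /S pair_coefC.
by rewrite IHk // addnS addSn; case: (odd k).
Qed.

Lemma alternating_simple a b k : simple a -> simple b ->
  let S := chebyshev (pair_coef a b) in
  refl_word D (alternating a b k) a =
  S k.+1 *: (if odd k then b else a) + S k *: (if odd k then a else b).
Proof.
move=> sa sb S; have := alternating_action k 0 sa sb; rewrite /= !add0n.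
by rewrite scale1r scale0r addr0.
Qed.

Section Braid.
Variables (a b : V) (m : nat).
Hypotheses (sa : simple a) (sb : simple b) (m2 : (2 <= m)%N).
Hypothesis ab : '[a, b] = - cos (pi / m%:R).

Lemma pair_coef_angle : pair_coef a b = 2 * cos (pi / m%:R).
Proof. by rewrite /pair_coef ab mulrN opprK. Qed.

Lemma alternating_angle_left :
  refl_word D (alternating a b m) a = - (if odd m then b else a).
Proof.
rewrite alternating_simple // pair_coef_angle.
by rewrite chebyshev_angle_m // chebyshev_angle_mS // scale0r addr0 scaleN1r.
Qed.

Lemma alternating_angle_right :
  refl_word D (alternating b a m) a = - (if odd m then b else a).
Proof.
rewrite -(ltn_predK m2) /= refl_word_rcons refl_self // refl_wordN.
rewrite alternating_simple // (ltn_predK m2) pair_coef_angle.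
rewrite chebyshev_angle_m // chebyshev_angle_pred // scale0r add0r scale1r.
by case: (odd m.-1).
Qed.

End Braid.

(** The braid relation.  Both sides are isometries that agree on [a] and [b];
  their difference takes values in the plane of [a] and [b] and is orthogonal
  to it, and the form is non-degenerate on that plane. *)
Lemma braid a b m : simple a -> simple b -> (2 <= m)%N ->
  '[a, b] = - cos (pi / m%:R) ->
  refl_word D (alternating a b m) = refl_word D (alternating b a m).
Proof.
move=> sa sb m2 ab; apply: funext => v.
have ba : '[b, a] = - cos (pi / m%:R) by rewrite bformC.
set f := refl_word D (alternating a b m).
set g := refl_word D (alternating b a m).
have aab := alternating_sub a b m.
have aba : all (pred2 a b) (alternating b a m).
  by apply: sub_all (alternating_sub b a m) => c /=; rewrite orbC.
have isof u u' : '[f u, f u'] = '[u, u'].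
  by apply: refl_word_isometry; apply: pair_word_simple aab.
have isog u u' : '[g u, g u'] = '[u, u'].
  by apply: refl_word_isometry; apply: pair_word_simple aba.
have fa : f a = g a.
  rewrite /f /g (alternating_angle_left sa sb m2 ab).
  by rewrite (alternating_angle_right sa sb m2 ab).
have fb : f b = g b.
  rewrite /f /g (alternating_angle_left sb sa m2 ba).
  by rewrite (alternating_angle_right sb sa m2 ba).
have orth u : f u = g u -> '[f v - g v, f u] = 0.
  by move=> fu; rewrite linearBl /= isof fu isog subrr.
have {}orth : '[f v - g v, a] = 0 /\ '[f v - g v, b] = 0.
  move: (orth a fa) (orth b fb).
  rewrite /f (alternating_angle_left sa sb m2 ab).
  rewrite (alternating_angle_right sb sa m2 ba).
  by rewrite !linearNr /=; case: (odd m) => /eqP; rewrite oppr_eq0 => /eqP -> /eqP;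
    rewrite oppr_eq0 => /eqP ->.
have [x [y fgv]] : exists x y : R, f v - g v = x *: a + y *: b.
  rewrite /f /g; have [x1 [y1 ->]] := refl_word_pair v aab.
  have [x2 [y2 ->]] := refl_word_pair v aba.
  exists (x1 - x2), (y1 - y2).
  by rewrite opprD addrACA subrr add0r !scalerBl opprD addrACA.
move: orth; rewrite fgv !linearDl !linearZl_LR /= ab ba !simple_norm1 //.
set c := cos _ => -[Ea Eb].
have cs : c ^+ 2 + sin (pi / m%:R) ^+ 2 = 1 by exact: cos2Dsin2.
have s0 := sin_pi_div_gt0 m2.
have s20 : sin (pi / m%:R) ^+ 2 != 0 :> R by rewrite expf_neq0 // lt0r_neq0.
have x0 : x = 0.
  apply: (mulIf s20); rewrite mul0r (_ : sin _ ^+ 2 = 1 - c ^+ 2); last lra.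
  have yE : y = x * c by lra.
  by rewrite yE in Ea; lra.
have y0 : y = 0 by move: Eb; rewrite x0; lra.
by apply/eqP; rewrite -subr_eq0 fgv x0 y0 !scale0r addr0.
Qed.

Lemma pair_coef_cases a b : simple a -> simple b -> a <> b ->
  let S := chebyshev (pair_coef a b) in
  (forall k, 0 <= S k) \/
  exists m, [/\ (0 < m)%N, forall k, (k <= m)%N -> 0 <= S k
    & refl_word D (alternating a b m) = refl_word D (alternating b a m)].
Proof.
move=> sa sb nab S; case: (simple_form sa sb nab) => [[m m2 ab]|ab]; last first.
  by left => k; apply: chebyshev_ge0; rewrite /pair_coef; lra.
right; exists m; split; first by rewrite ltnW.
  by move=> k km; rewrite /S (pair_coef_angle ab) chebyshev_angle_ge0.
exact: braid.
Qed.

(** A word in two letters either alternates or has two equal adjacent letters,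
  which cancel. *)
Lemma pair_word_reduce a b t : simple a -> simple b -> all (pred2 a b) t ->
  [\/ t = alternating a b (size t), t = alternating b a (size t)
    | exists t', [/\ all (pred2 a b) t', (size t' < size t)%N
        & refl_word D t' = refl_word D t]].
Proof.
have main a' b' s : simple b' -> all (pred2 a' b') s ->
    s = alternating a' b' (size s) ->
  [\/ rcons s b' = alternating a' b' (size (rcons s b')),
     rcons s b' = alternating b' a' (size (rcons s b'))
    | exists t', [/\ all (pred2 a' b') t', (size t' < size (rcons s b'))%N
        & refl_word D t' = refl_word D (rcons s b')]].
  move=> sb'; case/lastP: s => [|s c] sab; first by constructor 1.
  rewrite size_rcons /= => /rcons_inj[_ ->]; constructor 3; exists s.
  split; first by move: sab; rewrite all_rcons => /andP[].
    by rewrite !size_rcons.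
  by apply: funext => v; rewrite !refl_word_rcons reflK.
move=> sa sb; elim/last_ind: t => [|t c IHt]; first by constructor 1.
rewrite all_rcons => /andP[/= cab tab]; case: (IHt tab) => [tE|tE|].
- case/orP: cab => /eqP ->; last exact: main.
  by constructor 2; rewrite size_rcons /= -tE.
- case/orP: cab => /eqP ->; last by constructor 1; rewrite size_rcons /= -tE.
  have tba : all (pred2 b a) t by apply: sub_all tab => e /=; rewrite orbC.
  case: (main b a t sa tba tE); [by constructor 2|by constructor 1|].
  move=> [t' [t'ba t's t't]]; constructor 3; exists t'; split => //.
  by apply: sub_all t'ba => e /=; rewrite orbC.
move=> [t' [t'ab t's t't]]; constructor 3; exists (rcons t' c); split.
- by rewrite all_rcons /= cab.
- by rewrite !size_rcons ltnS.
- by apply: funext => v; rewrite !refl_word_rcons t't.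
Qed.

(** Rank two case of the link between length and positivity.  For an alternating
  word ending in [b] the image of [a] has Chebyshev coefficients, which are
  non-negative unless the word has length at least [m]; in that case the braid
  relation makes it end in [a], and this letter cancels. *)
Lemma pair_exchange a b t : simple a -> simple b -> a <> b ->
  all (pred2 a b) t ->
  nonneg_span [set a; b] (refl_word D t a) \/
  exists t', [/\ all (pred2 a b) t', (size t' < size t)%N
    & refl_word D t' = refl_word D t \o refl D a].
Proof.
move=> sa sb nab; have [n] := ubnP (size t); elim: n t => // n IHn t.
rewrite ltnS => tn tab.
case: (pair_word_reduce sa sb tab) => [tE|tE|[t' [t'ab t't E]]].
- have := pair_coef_cases sa sb nab.
  set S := chebyshev _ => /= cases.
  have ta : 0 <= S (size t) -> 0 <= S (size t).+1 ->
      nonneg_span [set a; b] (refl_word D t a).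
    move=> S0 S1; rewrite tE alternating_simple //.
    have sub := @sub_nonneg_span _ _ [set a; b].
    by apply: nonneg_spanD; apply: nonneg_spanZ => //; apply: sub;
      case: odd; [right|left|left|right].
  case: cases => [S0|[m [m0 S0 br]]]; first by left; apply: ta.
  case: (ltnP (size t) m) => tm.
    by left; apply: ta; apply: S0 => //; exact: ltnW.
  right; have [p pab] := alternating_split a b tm; rewrite -tE => ->.
  exists (p ++ alternating a b m.-1); split.
  - by rewrite all_cat pab alternating_sub.
  - by rewrite !size_cat !size_alternating ltn_add2l prednK.
  rewrite !refl_word_cat br -compA; congr (_ \o _); apply: funext => v /=.
  by rewrite -{2}(prednK m0) /= refl_word_rcons reflK.
- move: tE; case/lastP: t tn tab => [|t c] tn tab.
    by move=> _; left; apply: sub_nonneg_span; left.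
  rewrite size_rcons /= => /rcons_inj[_ ->]; right; exists t; split.
  - by move: tab; rewrite all_rcons => /andP[].
  - exact: ltnSn.
  - by apply: funext => v /=; rewrite refl_word_rcons reflK.
- case: (IHn t' (leq_trans t't tn) t'ab).
    by rewrite E; left.
  move=> [t2 [t2ab t2t' E2]]; right; exists t2; split => //.
    exact: ltn_trans t't.
  by rewrite E2 E.
Qed.

End RankTwo.

(** * Length and positivity of roots *)

Section Roots.
Context (R : realType) (V : lmodType R) (D : simple_system V).
Implicit Types (u v a b : V) (w x y z : weyl D) (s t : seq V).

Local Notation "''[' u , v ]" := (bform D u v).
Local Notation simple := (simple_root D).
Local Notation positive := (nonneg_span (simple_root D)).
Local Notation root := (root_system D).
Local Notation len := (@weyl_length R V D).

(** A total function of [a], with value [1] if the reflection in [a] is not in the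
  group; this avoids carrying a proof that [a] is simple. *)
Definition simple_refl a : weyl D :=
  xget 1%g [set w : weyl D | w = refl D a :> (V -> V)].

Lemma simple_reflE a : simple a -> simple_refl a = refl D a :> (V -> V).
Proof.
move=> sa; have [|w wE] := @weyl_of_word _ _ D [:: a].
  by move=> b /=; rewrite inE => /eqP ->.
by rewrite /simple_refl; case: xgetP => [_ _ //|/(_ w)]; case.
Qed.

Lemma simple_reflK a : simple a -> (simple_refl a * simple_refl a)%g = 1%g.
Proof.
move=> sa; apply: weyl_inj; apply: funext => v.
by rewrite weylM simple_reflE // reflK.
Qed.

Lemma simple_reflV a : simple a -> ((simple_refl a)^-1)%g = simple_refl a.
Proof.
by move=> sa; rewrite -[RHS](mulKg (simple_refl a)) simple_reflK // mulg1.
Qed.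

Lemma length_word_mul w x t : [set` t] `<=` simple ->
  x = w \o refl_word D t :> (V -> V) -> (len x <= len w + size t)%N.
Proof.
move=> tP xE; have [s [sP <- wE]] := weyl_lengthP w.
rewrite -size_cat; apply: weyl_length_min; last by rewrite refl_word_cat -wE.
by move=> c /=; rewrite mem_cat => /orP[/sP|/tP].
Qed.

Lemma length_mul_simple w a : simple a ->
  (len (w * simple_refl a)%g <= (len w).+1)%N.
Proof.
move=> sa; rewrite -addn1; apply: (@length_word_mul w _ [:: a]).
  by move=> b /=; rewrite inE => /eqP ->.
by apply: funext => v; rewrite weylM simple_reflE.
Qed.

Lemma lengthV w : len (w^-1)%g = len w.
Proof.
suff le x : (len (x^-1)%g <= len x)%N.
  by apply/eqP; rewrite eqn_leq le /= -{1}(invgK w) le.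
have [s [sP <- xE]] := weyl_lengthP x; rewrite -size_rev.
apply: weyl_length_min; first by move=> c /=; rewrite mem_rev => /sP.
by apply: funext => v; rewrite -{2}(weylVK x v) xE refl_word_rev.
Qed.

Lemma length_simple_mul w a : simple a ->
  (len (simple_refl a * w)%g <= (len w).+1)%N.
Proof.
move=> sa; rewrite -lengthV invgM simple_reflV // -(lengthV w).
exact: length_mul_simple.
Qed.

Lemma right_descent w : w <> 1%g ->
  exists2 b, simple b & (len (w * simple_refl b)%g < len w)%N.
Proof.
have [s [+ sz +]] := weyl_lengthP w.
case/lastP: s sz => [|s b] sz sP wE w1; first by case: w1; apply: weyl_inj.
have sb : simple b by apply: sP; rewrite /= mem_rcons inE eqxx.
exists b => //; rewrite -sz size_rcons ltnS; apply: weyl_length_min.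
  by move=> c cs; apply: sP; rewrite /= mem_rcons inE (_ : c \in s) ?orbT.
by apply: funext => v; rewrite weylM wE refl_word_rcons simple_reflE // reflK.
Qed.

(** A right descent of [x] in the dihedral group of [a] and [b] can be moved to the
  front of [t] without changing the total length; this stops because it makes [x]
  shorter. *)
Lemma dihedral_factor w a b : simple a -> simple b ->
  exists x t, [/\ all (pred2 a b) t, w = x \o refl_word D t :> (V -> V),
    (len x + size t)%N = len w, (len x <= len (x * simple_refl a)%g)%N
    & (len x <= len (x * simple_refl b)%g)%N].
Proof.
move=> sa sb.
set goal := ex _.
suff main n x t : (len x < n)%N -> all (pred2 a b) t ->
    w = x \o refl_word D t :> (V -> V) -> (len x + size t)%N = len w -> goal.
  by apply: (main (len w).+1 w [::]) => //; rewrite addn0.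
elim: n x t => // n IHn x t; rewrite ltnS => xn tab wE lw.
have step c : pred2 a b c -> (len (x * simple_refl c)%g < len x)%N -> goal.
  move=> cab lc; have sc : simple c by case/orP: cab => /eqP ->.
  have wE' : w = (x * simple_refl c)%g \o refl_word D (c :: t) :> (V -> V).
    by rewrite wE; apply: funext => v /=; rewrite simple_reflE // reflK.
  have ctab : all (pred2 a b) (c :: t) by apply/andP.
  apply: (IHn (x * simple_refl c)%g (c :: t)) => //; first exact: leq_trans lc xn.
  apply/eqP; rewrite eqn_leq; apply/andP; split; last first.
    by apply: length_word_mul => //; apply: pair_word_simple ctab.
  by rewrite -lw /= addnS -addSn leq_add2r.
case: (leqP (len x) (len (x * simple_refl a)%g)) => la; last first.
  by apply: step la; rewrite /= eqxx.
case: (leqP (len x) (len (x * simple_refl b)%g)) => lb; last first.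
  by apply: step lb; rewrite /= eqxx orbT.
by exists x, t.
Qed.

Lemma weyl_nonneg_span (P Q : set V) w : (forall a, P a -> nonneg_span Q (w a)) ->
  forall v, nonneg_span P v -> nonneg_span Q (w v).
Proof.
move=> PQ; apply: (@nonneg_span_ind _ _ _ [set v | nonneg_span Q (w v)]) => /=.
- by rewrite weyl0; apply: nonneg_span0.
- by move=> u v Qu Qv; rewrite weylD; apply: nonneg_spanD.
- by move=> k v k0 Qv; rewrite weylZ; apply: nonneg_spanZ.
- exact: PQ.
Qed.

Lemma weyl_nonneg_spanN (P Q : set V) w :
  (forall a, P a -> nonneg_span Q (- w a)) ->
  forall v, nonneg_span P v -> nonneg_span Q (- w v).
Proof.
move=> PQ; apply: (@nonneg_span_ind _ _ _ [set v | nonneg_span Q (- w v)]) => /=.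
- by rewrite weyl0 oppr0; apply: nonneg_span0.
- by move=> u v Qu Qv; rewrite weylD opprD; apply: nonneg_spanD.
- by move=> k v k0 Qv; rewrite weylZ -scalerN; apply: nonneg_spanZ.
- exact: PQ.
Qed.

(** Let [b] be the last letter of a reduced word of [w], and write [w] as [x] times
  a dihedral word [t] in [a] and [b], with [x a] and [x b] positive by induction
  on length.  By [pair_exchange] either [t a], and hence [w a], is a non-negative
  combination of positive vectors, or the word for [w] followed by the reflection
  in [a] can be shortened, against the hypothesis on lengths. *)
Lemma positive_of_length w a : simple a ->
  (len w <= len (w * simple_refl a)%g)%N -> positive (w a).
Proof.
have [n] := ubnP (len w); elim: n w a => // n IHn w a; rewrite ltnS => wn sa la.
have [->|/eqP/right_descent[b sb lb]] := eqVneq w 1%g.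
  by rewrite weyl1; apply: sub_nonneg_span.
have nab : a <> b by move=> ab; move: lb; rewrite -ab ltnNge la.
have [x [t [tab wE lw xa xb]]] := dihedral_factor w sa sb.
have xw : (len x < len w)%N.
  rewrite -lw -[X in (X < _)%N]addn0 ltn_add2l lt0n size_eq0; apply/eqP => t0.
  have xE : w = x by apply: weyl_inj; rewrite wE t0.
  by move: lb; rewrite xE ltnNge xb.
have xn := leq_trans xw wn.
have xcone : forall c, [set a; b] c -> positive (x c).
  by move=> c [->|->]; apply: IHn.
case: (pair_exchange sa sb nab tab) => [ta|[t' [t'ab t't tE]]].
  by rewrite wE /=; apply: weyl_nonneg_span ta.
move: la; rewrite leqNgt (leq_ltn_trans (@length_word_mul x _ t' _ _)) //.
- exact: pair_word_simple t'ab.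
- by apply: funext => v; rewrite weylM simple_reflE // wE tE.
- by rewrite -lw ltn_add2l.
Qed.

Lemma negative_of_length w a : simple a ->
  (len (w * simple_refl a)%g < len w)%N -> positive (- w a).
Proof.
move=> sa la; have := @positive_of_length (w * simple_refl a)%g a sa.
rewrite -mulgA simple_reflK // mulg1 => /(_ (ltnW la)).
by rewrite weylM simple_reflE // refl_self // weylN.
Qed.

Lemma root_simple a : simple a -> root a.
Proof. by move=> sa; exists 1%g => //; exists a. Qed.

Lemma root_weyl w v : root v -> root (w v).
Proof. by move=> [x _ [a sa <-]]; exists (w * x)%g => //; exists a. Qed.

Lemma rootN v : root v -> root (- v).
Proof.
move=> [x _ [a sa <-]]; exists (x * simple_refl a)%g => //; exists a => //.
by rewrite weylM simple_reflE // refl_self // weylN.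
Qed.

Lemma root_norm v : root v -> '[v, v] = 1.
Proof. by move=> [x _ [a sa <-]]; rewrite weyl_isometry simple_norm1. Qed.

Lemma root_sign v : root v -> positive v \/ positive (- v).
Proof.
move=> [x _ [a sa <-]].
case: (leqP (len x) (len (x * simple_refl a)%g)) => la.
  by left; apply: positive_of_length.
by right; apply: negative_of_length.
Qed.

Lemma root_not_both v : root v -> positive v -> ~ positive (- v).
Proof.
move=> rv vp vn; have := root_norm rv.
by rewrite (positive_salient vp vn) linear0l => /eqP; rewrite eq_sym oner_eq0.
Qed.

Lemma length_lt_of_positive w a : simple a ->
  positive (w a) -> (len w < len (w * simple_refl a)%g)%N.
Proof.
move=> sa wa; rewrite ltnNge; apply/negP => le.
have := @positive_of_length (w * simple_refl a)%g a sa.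
rewrite -mulgA simple_reflK // mulg1 weylM simple_reflE // refl_self // weylN.
by move=> /(_ le); apply: root_not_both wa; apply/root_weyl/root_simple.
Qed.

Lemma length_lt_of_negative w a : simple a ->
  positive (- w a) -> (len (w * simple_refl a)%g < len w)%N.
Proof.
move=> sa wa; rewrite ltnNge; apply/negP => /(positive_of_length sa) wp.
by move: wa; apply: root_not_both wp; apply/root_weyl/root_simple.
Qed.

(** If the image of [v] were negative, [v] would be a summand of a multiple of [a]
  in the positive cone, hence equal to [a] by extremality. *)
Lemma refl_positive a v : simple a -> root v -> positive v -> v <> a ->
  positive (refl D a v).
Proof.
move=> sa rv vp va; have : root (refl D a v).
  by rewrite -simple_reflE //; apply: root_weyl.
case/root_sign => // nv; case: va.
have [|c c0 vE] := @simple_extremal _ _ D a (2 * '[v, a]) v _ sa vp nv.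
  by rewrite /refl opprB addrCA subrr addr0.
have := root_norm rv; rewrite vE linearZl_LR linearZr_LR /= simple_norm1 // mulr1.
move=> c2; have -> : c = 1 by nra.
by rewrite scale1r.
Qed.

(** * Inversion sets and the weak order *)

Lemma inversionsP z v : inversions z v <->
  [/\ root v, positive v & positive (- (z^-1)%g v)].
Proof.
split=> [[[rv vp] [_ [u [ru up] <-] zu]]|[rv vp zv]].
  by split=> //; rewrite -zu weylK opprK.
split; first by split.
exists ((z^-1)%g v); last exact: weylVK.
exists (- (z^-1)%g v); last exact: opprK.
by split=> //; apply/rootN/root_weyl.
Qed.

Lemma inversions_root z v : inversions z v -> root v.
Proof. by case/inversionsP. Qed.

Lemma inversions_positive z v : inversions z v -> positive v.
Proof. by case/inversionsP. Qed.

Lemma inversions_negative z v : inversions z v -> ~ positive ((z^-1)%g v).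
Proof.
move=> /inversionsP[rv _ zn] zp; apply: root_not_both zp zn; exact: root_weyl.
Qed.

Lemma inversions_intro z v : root v -> positive v -> ~ positive ((z^-1)%g v) ->
  inversions z v.
Proof.
move=> rv vp zv; apply/inversionsP; split=> //.
by case: (root_sign (root_weyl (z^-1)%g rv)).
Qed.

Lemma inversions1 : inversions (1%g : weyl D) = set0.
Proof.
apply/seteqP; split=> // v vi; have := inversions_negative vi.
by rewrite invg1 weyl1; apply; apply: inversions_positive vi.
Qed.

Lemma inversions_simple x a : simple a ->
  inversions x a <-> (len (simple_refl a * x)%g < len x)%N.
Proof.
move=> sa; rewrite -(lengthV x) -lengthV invgM simple_reflV //; split.
  by move=> /inversionsP[_ _]; apply: length_lt_of_negative.
move=> /(negative_of_length sa) xa; apply/inversionsP; split=> //.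
  exact: root_simple.
exact: sub_nonneg_span.
Qed.

Lemma inversions_simple_refl a v : simple a ->
  inversions (simple_refl a) v -> v = a.
Proof.
move=> sa vi; apply: contrapT => va; have := inversions_negative vi.
rewrite simple_reflV // simple_reflE //; apply; apply: refl_positive => //.
  exact: inversions_root vi.
exact: inversions_positive vi.
Qed.

Lemma inversions_simple_mul x a v : simple a -> root v -> positive v -> v <> a ->
  inversions (simple_refl a * x)%g v <-> inversions x (refl D a v).
Proof.
move=> sa rv vp va.
have E : ((simple_refl a * x)^-1)%g v = (x^-1)%g (refl D a v).
  by rewrite invgM weylM simple_reflV // simple_reflE.
split=> [/inversionsP[_ _]|/inversionsP[_ _]].
  rewrite E => xv; apply/inversionsP; split=> //; last exact: refl_positive.
  by rewrite -simple_reflE //; apply: root_weyl.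
by move=> xv; apply/inversionsP; rewrite E.
Qed.

Lemma weak_length x y : (x <= y)%O -> len y = (len x + len (x^-1 * y)%g)%N.
Proof. by move=> /eqP. Qed.

Lemma left_descent x : x <> 1%g ->
  exists2 a, simple a & (len (simple_refl a * x)%g < len x)%N.
Proof.
move=> x1; have [|a sa la] := @right_descent (x^-1)%g.
  by move=> E; apply: x1; rewrite -[x]invgK E invg1.
by exists a => //; rewrite -(lengthV x) -lengthV invgM simple_reflV.
Qed.

(** Peeling a left descent off both elements proves both directions by induction
  on the length of [x], without counting inversions. *)
Lemma weak_leP x y : (x <= y)%O <-> inversions x `<=` inversions y.
Proof.
have [n] := ubnP (len x); elim: n x y => // n IHn x y; rewrite ltnS => xn.
have [->|/eqP/left_descent[a sa lx]] := eqVneq x 1%g.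
  rewrite inversions1; split => // _; change (weak_le 1%g y).
  by rewrite /weak_le weyl_length1 invg1 mul1g add0n.
have [x' x'E] : {x' | x' = (simple_refl a * x)%g} by eexists.
have [y' y'E] : {y' | y' = (simple_refl a * y)%g} by eexists.
have xE : (simple_refl a * x')%g = x by rewrite x'E mulgA simple_reflK // mul1g.
have yE : (simple_refl a * y')%g = y by rewrite y'E mulgA simple_reflK // mul1g.
have quot : (x'^-1 * y')%g = (x^-1 * y)%g.
  rewrite x'E y'E invgM simple_reflV // -mulgA.
  by rewrite (mulgA (simple_refl a)) simple_reflK // mul1g.
have lenx : len x = (len x').+1.
  by apply/eqP; rewrite eqn_leq x'E lx andbT -x'E -{1}xE length_simple_mul.
have leny : (len y <= (len y').+1)%N by rewrite -{1}yE length_simple_mul.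
have [|IH1 IH2] := IHn x' y'; first by rewrite x'E; exact: leq_trans lx xn.
have xa : inversions x a by apply/inversions_simple.
have x'a : ~ inversions x' a.
  by move/(inversions_simple _ sa); rewrite xE lenx => /ltnW; rewrite ltnn.
split=> [xy|sub].
  have ly := weak_length xy.
  have ly' : len y' = (len x' + len (x'^-1 * y')%g)%N.
    apply/eqP; rewrite eqn_leq; apply/andP; split.
      by have := weyl_lengthM x' (x'^-1 * y')%g; rewrite mulVKg.
    by rewrite quot -ltnS (leq_trans _ leny) // ly lenx.
  have x'y' : (x' <= y')%O by change (weak_le x' y'); apply/eqP.
  have ya : inversions y a.
    apply/inversions_simple => //; rewrite -y'E ly' ly quot lenx.
    by rewrite addSn.
  move=> v vi; have [->//|/eqP va] := eqVneq v a.
  have [rv vp _] := iffLR (inversionsP _ _) vi.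
  move: vi; rewrite -xE -yE !inversions_simple_mul //; exact: (IH1 x'y').
have ya := sub a xa.
have ly' : len y = (len y').+1.
  by apply/eqP; rewrite eqn_leq leny y'E /=; apply/inversions_simple.
have x'y' : (x' <= y')%O.
  apply: IH2 => v vi; have va : v <> a by move=> va; apply: x'a; rewrite -va.
  have [rv vp _] := iffLR (inversionsP _ _) vi.
  have rv' : root (refl D a v) by rewrite -simple_reflE //; apply: root_weyl.
  have vp' := refl_positive sa rv vp va.
  have va' : refl D a v <> a.
    move=> E; have : v = - a by rewrite -(reflK sa v) E refl_self.
    move=> vE; apply: (root_not_both rv vp); rewrite vE opprK.
    exact: sub_nonneg_span.
  have : inversions x (refl D a v).
    by rewrite -xE inversions_simple_mul // reflK.
  by move=> /sub; rewrite -yE inversions_simple_mul // reflK.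
change (weak_le x y); apply/eqP.
by rewrite ly' (weak_length x'y') quot lenx addSn.
Qed.

Lemma weak_leq_length x y : (x <= y)%O -> (len x <= len y)%N.
Proof. by move/weak_length ->; apply: leq_addr. Qed.

Lemma weak_le_eq x y : (x <= y)%O -> (len y <= len x)%N -> x = y.
Proof.
move=> xy; rewrite (weak_length xy) -{2}[len x]addn0 leq_add2l leqn0 => /eqP.
by move/weyl_length_eq0 => q; rewrite -(mulVKg x y) q mulg1.
Qed.

Lemma weak_le1 x : (1%g <= x :> weyl D)%O.
Proof. by apply/weak_leP; rewrite inversions1. Qed.

(** An inversion [v] of [x] with [z v] negative makes [- z v] an inversion of [z]
  that is not one of [z * x], and conversely. *)
Lemma weak_le_mulP z x :
  (z <= (z * x)%g :> weyl D)%O <-> (forall v, inversions x v -> positive (z v)).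
Proof.
split=> [/weak_leP sub v vi|zx].
  case: (root_sign (root_weyl z (inversions_root vi))) => // zv.
  have /sub /inversions_negative : inversions z (- z v).
    apply/inversionsP; split=> //; first exact/rootN/root_weyl/(inversions_root vi).
    by rewrite weylN weylK opprK; apply: inversions_positive vi.
  rewrite invgM weylM weylN weylK weylN; case.
  by case/inversionsP: vi.
apply/weak_leP => v /inversionsP[rv vp zv]; apply: inversions_intro => //.
rewrite invgM weylM => xv.
have /zx : inversions x (- (z^-1)%g v).
  apply/inversionsP; split=> //; first exact/rootN/root_weyl.
  by rewrite weylN opprK.
by rewrite weylN weylVK; apply: root_not_both.
Qed.

Lemma inversions_mul z x v : (z <= (z * x)%g :> weyl D)%O ->
  inversions (z * x)%g v <-> inversions z v \/ inversions x ((z^-1)%g v).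
Proof.
move=> zx; split=> [/inversionsP[rv vp]|[|vi]].
- rewrite invgM weylM => xv.
  case: (root_sign (root_weyl (z^-1)%g rv)) => zv; last by left; apply/inversionsP.
  by right; apply/inversionsP; split=> //; apply: root_weyl.
- by move: v; apply/weak_leP.
- have := iffLR (weak_le_mulP z x) zx _ vi; rewrite weylVK => vp.
  have [rv _ xv] := iffLR (inversionsP _ _) vi.
  apply/inversionsP; rewrite invgM weylM; split=> //.
  by rewrite -(weylVK z v); apply: root_weyl.
Qed.

End Roots.

(** * Joins and meets in the weak order *)

Section Joins.
Context (R : realType) (V : lmodType R) (D : simple_system V).
Implicit Types (e a b : V) (u v w x y z : weyl D) (t : seq V).

Local Notation simple := (simple_root D).
Local Notation positive := (nonneg_span (simple_root D)).
Local Notation root := (root_system D).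
Local Notation len := (@weyl_length R V D).

(** A negative coefficient can be moved to the other side, where extremality of the
  remaining simple root applies. *)
Lemma positive_pair a b (p q : R) : simple a -> simple b ->
  positive (p *: a + q *: b) -> nonneg_span [set a; b] (p *: a + q *: b).
Proof.
move=> sa sb pos.
have Pa : nonneg_span [set a; b] a by apply: sub_nonneg_span; left.
have Pb : nonneg_span [set a; b] b by apply: sub_nonneg_span; right.
case: (lerP 0 p) => p0; last first.
  have [||c c0 ->] := @simple_extremal _ _ D b q (p *: a + q *: b)
    (- p *: a) sb pos.
  - by apply: nonneg_spanZ; [rewrite oppr_ge0 ltW|apply: sub_nonneg_span].
  - by rewrite addrAC -scalerDl subrr scale0r add0r.
  exact: nonneg_spanZ.
case: (lerP 0 q) => q0; last first.
  have [||c c0 ->] := @simple_extremal _ _ D a p (p *: a + q *: b)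
    (- q *: b) sa pos.
  - by apply: nonneg_spanZ; [rewrite oppr_ge0 ltW|apply: sub_nonneg_span].
  - by rewrite -addrA -scalerDl subrr scale0r addr0.
  exact: nonneg_spanZ.
by apply: nonneg_spanD; apply: nonneg_spanZ.
Qed.

Lemma nonneg_span_pairP a b e : nonneg_span [set a; b] e ->
  exists p q : R, e = p *: a + q *: b.
Proof.
apply: (@nonneg_span_ind _ _ _ [set e | exists p q : R, e = p *: a + q *: b]).
- by exists 0, 0; rewrite !scale0r addr0.
- move=> _ _ [p [q ->]] [p' [q' ->]]; exists (p + p'), (q + q').
  by rewrite !scalerDl addrACA.
- by move=> k _ _ [p [q ->]]; exists (k * p), (k * q); rewrite scalerDr !scalerA.
- move=> _ [->|->]; first by exists 1, 0; rewrite scale1r scale0r addr0.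
  by exists 0, 1; rewrite scale1r scale0r add0r.
Qed.

Lemma inversions_pair_word a b t w : simple a -> simple b -> all (pred2 a b) t ->
  w = refl_word D t :> (V -> V) -> inversions w `<=` nonneg_span [set a; b].
Proof.
move=> sa sb; elim: t w => [|c t IHt] w.
  move=> _ w1; have -> : w = 1%g by apply: weyl_inj.
  by rewrite inversions1.
move=> /= /andP[cab tab] wE e ei.
have sc : simple c by case/orP: cab => /eqP ->.
have Pc : [set a; b] c by case/orP: cab => /eqP ->; [left|right].
have [->|/eqP ec] := eqVneq e c; first exact: sub_nonneg_span.
have [x xE] := weyl_of_word (pair_word_simple sa sb tab).
have wxE : w = (simple_refl D c * x)%g.
  by apply: weyl_inj; apply: funext => f; rewrite weylM simple_reflE // xE wE.
have [re ep _] := iffLR (inversionsP _ _) ei.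
move: ei; rewrite wxE inversions_simple_mul //.
move=> /(IHt x tab xE)/nonneg_span_pairP[p [q E]].
have [p' [q' eE]] : exists p' q' : R, e = p' *: a + q' *: b.
  rewrite -(reflK sc e) E.
  case/orP: cab => /eqP ->; last by rewrite refl_pair //; eexists; eexists.
  by rewrite addrC refl_pair // addrC; eexists; eexists.
by rewrite eE; apply: positive_pair => //; rewrite -eE.
Qed.

Lemma inversions_convex y (P : set V) e : P `<=` inversions y -> root e ->
  nonneg_span P e -> inversions y e.
Proof.
move=> Py re Pe; apply/inversionsP; split=> //.
  apply: nonneg_span_sub Pe => a /Py; exact: inversions_positive.
by apply: weyl_nonneg_spanN Pe => a /Py /inversionsP[].
Qed.

Lemma ex_max_length (P : weyl D -> Prop) N : (exists w, P w) ->
  (forall w, P w -> (len w <= N)%N) ->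
  exists2 w, P w & forall x, P x -> (len x <= len w)%N.
Proof.
move=> [w0 Pw0] bound.
pose Q n := `[< exists2 w, P w & len w = n >].
have exQ : exists n, Q n by exists (len w0); apply/asboolP; exists w0.
have bQ n : Q n -> (n <= N)%N by move=> /asboolP[w /bound + <-].
case: (ex_maxnP exQ bQ) => n /asboolP[w Pw lw] max; exists w => // x Px.
by rewrite lw; apply: max; apply/asboolP; exists x.
Qed.

(** The join of two simple reflections is the longest element [w] of the dihedral
  group that they generate: the inversion set of an upper bound is convex, hence
  contains those of all elements of the dihedral group, whose lengths are
  therefore bounded. *)
Lemma simple_join a b y : simple a -> simple b -> inversions y a ->
  inversions y b ->
  exists w, [/\ inversions w a, inversions w b,
    forall y', inversions y' a -> inversions y' b -> (w <= y')%O
    & inversions w `<=` nonneg_span [set a; b]].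
Proof.
move=> sa sb ya yb.
pose dih w := exists2 t, all (pred2 a b) t & w = refl_word D t :> (V -> V).
have dih_cone w : dih w -> inversions w `<=` nonneg_span [set a; b].
  by move=> [t tab wE]; apply: inversions_pair_word tab wE.
have dih_le w y' : dih w -> inversions y' a -> inversions y' b -> (w <= y')%O.
  move=> dw y'a y'b; apply/weak_leP => e ei.
  apply: (@inversions_convex _ [set a; b]); last exact: dih_cone ei.
    by move=> c [->|->].
  exact: inversions_root ei.
(* A longest element [w] sends [a] and [b] to negative roots, so [w^-1] has them
   as inversions. *)
have [|w [t tab wE] max] := @ex_max_length dih (len y) _
    (fun w dw => weak_leq_length (dih_le w y dw ya yb)).
  by exists 1%g, [::].
have neg c : pred2 a b c -> simple c -> positive (- w c).
  move=> cab sc; case: (root_sign (root_weyl w (root_simple sc))) => // wc.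
  have := length_lt_of_positive sc wc; rewrite ltnNge max //.
  exists (rcons t c); first by rewrite all_rcons tab andbT.
  by apply: funext => e; rewrite weylM simple_reflE // refl_word_rcons wE.
have dw : dih (w^-1)%g.
  exists (rev t); first by rewrite all_rev.
  apply: funext => e; rewrite -{2}(weylVK w e) wE refl_word_rev //.
  exact: pair_word_simple tab.
exists (w^-1)%g; split.
- apply/inversionsP; rewrite invgK; split; first exact: root_simple.
    exact: sub_nonneg_span.
  by apply: neg => //; rewrite /= eqxx.
- apply/inversionsP; rewrite invgK; split; first exact: root_simple.
    exact: sub_nonneg_span.
  by apply: neg => //; rewrite /= eqxx orbT.
- by move=> y'; apply: dih_le.
- exact: dih_cone.
Qed.

Lemma weak_mul_simple z a : simple a -> positive (z a) ->
  (z <= (z * simple_refl D a)%g :> weyl D)%O.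
Proof.
by move=> sa za; apply/weak_le_mulP => e /(inversions_simple_refl sa) ->.
Qed.

Lemma weak_le_mul_simple z a y : simple a -> positive (z a) -> (z <= y)%O ->
  inversions y (z a) -> ((z * simple_refl D a)%g <= y :> weyl D)%O.
Proof.
move=> sa za zy ya; apply/weak_leP => e.
move=> /(inversions_mul _ (weak_mul_simple sa za))[|].
  by move: e; apply/weak_leP.
by move=> /(inversions_simple_refl sa) E; rewrite -(weylVK z e) E.
Qed.

Lemma weak_cover_below z u : (z <= u)%O -> z <> u ->
  exists a, [/\ simple a, positive (z a) & inversions u (z a)].
Proof.
have -> : u = (z * (z^-1 * u))%g by rewrite mulVKg.
set x := (z^-1 * u)%g => zx zu.
have [|a sa /(inversions_simple x sa) xa] := @left_descent _ _ D x.
  by move=> x1; apply: zu; rewrite x1 mulg1.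
have za := iffLR (weak_le_mulP z x) zx a xa.
by exists a; split=> //; apply/(inversions_mul _ zx); right; rewrite weylK.
Qed.

(** Translate by [z] the join of the two simple reflections. *)
Lemma cover_join z y a b : simple a -> simple b -> (z <= y)%O ->
  positive (z a) -> positive (z b) ->
  inversions y (z a) -> inversions y (z b) ->
  exists p, [/\ (z <= p)%O, inversions p (z a), inversions p (z b),
    forall y', (z <= y')%O -> inversions y' (z a) -> inversions y' (z b) ->
      (p <= y')%O
    & inversions p `<=` nonneg_span (inversions z `|` [set z a; z b])].
Proof.
move=> sa sb zy za zb ya yb.
have quot y' c : (z <= y')%O -> simple c -> positive (z c) ->
    inversions y' (z c) -> inversions (z^-1 * y')%g c.
  move=> zy' sc zc; rewrite -{1}(mulVKg z y') inversions_mul ?mulVKg //.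
  rewrite weylK => -[/inversions_negative|//]; rewrite weylK; case.
  exact: sub_nonneg_span.
have [w [wa wb wmin wcone]] :=
  simple_join sa sb (quot y a zy sa za ya) (quot y b zy sb zb yb).
have zw : (z <= (z * w)%g :> weyl D)%O.
  apply/weak_le_mulP => e /wcone; apply: weyl_nonneg_span.
  by move=> c [->|->].
exists (z * w)%g; split=> //.
- by apply/(inversions_mul _ zw); right; rewrite weylK.
- by apply/(inversions_mul _ zw); right; rewrite weylK.
- move=> y' zy' y'a y'b; apply/weak_leP => e /(inversions_mul _ zw)[|].
    by move: e; apply/weak_leP.
  move=> we; rewrite -(mulVKg z y').
  apply/inversions_mul; [by rewrite mulVKg|right].
  have /weak_leP :=
    wmin _ (quot y' a zy' sa za y'a) (quot y' b zy' sb zb y'b).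
  exact.
- move=> e /(inversions_mul _ zw)[ze|/wcone we].
    by apply: sub_nonneg_span; left.
  rewrite -(weylVK z e); apply: weyl_nonneg_span we => c [->|->];
    apply: sub_nonneg_span; right; [by left|by right].
Qed.

(** The inversion set of the join lies in the convex cone spanned by the inversion
  sets of the two elements.  Over a common lower bound [z], pick covers of [z]
  below [u] and [v], join them by [cover_join] to get [p], then join [u] with
  [p], [v] with [p], and the two results; each of these pairs has a common lower
  bound longer than [z]. *)
Lemma pair_join u v y : (u <= y)%O -> (v <= y)%O ->
  exists w, [/\ (u <= w)%O, (v <= w)%O,
    forall y', (u <= y')%O -> (v <= y')%O -> (w <= y')%O
    & inversions w `<=` nonneg_span (inversions u `|` inversions v)].
Proof.
suff main n z u' v' : (z <= u')%O -> (z <= v')%O -> (u' <= y)%O -> (v' <= y)%O ->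
  (len y <= len z + n)%N ->
  exists w, [/\ (u' <= w)%O, (v' <= w)%O,
    forall y', (u' <= y')%O -> (v' <= y')%O -> (w <= y')%O
    & inversions w `<=` nonneg_span (inversions u' `|` inversions v')].
  move=> uy vy; apply: (main (len y) 1%g) => //; try exact: weak_le1.
  exact: leq_addl.
elim: n z u' v' => [|n IHn] z {}u {}v zu zv uy vy lyz.
  have zy : z = y by apply: weak_le_eq; [exact: le_trans uy|rewrite addn0 in lyz].
  have uz : u = z by apply: le_anti; rewrite zu zy uy.
  have vz : v = z by apply: le_anti; rewrite zv zy vy.
  exists z; rewrite uz vz; split=> // e ez.
  by apply: sub_nonneg_span; left.
have [<-|/eqP zu'] := eqVneq z u.
  by exists v; split=> // e ev; apply: sub_nonneg_span; right.
have [<-|/eqP zv'] := eqVneq z v.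
  by exists u; split=> // e eu; apply: sub_nonneg_span; left.
have [a [sa za ua]] := weak_cover_below zu zu'.
have [b [sb zb vb]] := weak_cover_below zv zv'.
have inc x x' e : (x <= x')%O -> inversions x e -> inversions x' e.
  by move=> xx'; move: e; apply/weak_leP.
have zy := le_trans zu uy.
have [p [zp pa pb pmin pcone]] :=
  cover_join sa sb zy za zb (inc _ _ _ uy ua) (inc _ _ _ vy vb).
have py : (p <= y)%O.
  by apply: pmin => //; [exact: (inc _ _ _ uy ua)|exact: (inc _ _ _ vy vb)].
have lza := length_lt_of_positive sa za; have lzb := length_lt_of_positive sb zb.
have step c : (len z < len c)%N -> (len y <= len c + n)%N.
  by move=> lzc; apply: leq_trans lyz _; rewrite addnS -addSn leq_add2r.
have zap := weak_le_mul_simple sa za zp pa.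
have zbp := weak_le_mul_simple sb zb zp pb.
have [j [uj pj jmin jcone]] :=
  IHn _ u p (weak_le_mul_simple sa za zu ua) zap uy py (step _ lza).
have [k [vk pk kmin kcone]] :=
  IHn _ v p (weak_le_mul_simple sb zb zv vb) zbp vy py (step _ lzb).
have lp := leq_trans lza (weak_leq_length zap).
have [w [jw kw wmin wcone]] :=
  IHn p j k pj pk (jmin y uy py) (kmin y vy py) (step _ lp).
exists w; split.
- exact: le_trans jw.
- exact: le_trans kw.
- move=> y' uy' vy'; have py' : (p <= y')%O.
    apply: pmin; first exact: le_trans uy'.
      exact: inc uy' ua.
    exact: inc vy' vb.
  by apply: wmin; [apply: jmin|apply: kmin].
have subU (P : set V) : P `<=` inversions u `|` inversions v ->
    P `<=` nonneg_span (inversions u `|` inversions v).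
  by move=> sub e /sub; apply: sub_nonneg_span.
have pcone' : inversions p `<=` nonneg_span (inversions u `|` inversions v).
  move=> e /pcone; apply: nonneg_span_sub; apply: subU => f [|[->|->]].
  - by left; apply: inc zu _.
  - by left.
  - by right.
move=> e /wcone; apply: nonneg_span_sub => {}e [/jcone|/kcone];
  apply: nonneg_span_sub => {}e [ei|/pcone' //]; apply: sub_nonneg_span.
- by left.
- by right.
Qed.

(** Among the elements that are below all upper bounds of [X] and have inversions in
  the cone spanned by those of [X], take one of maximal length: joining it with
  any [x] in [X] stays in this class, so it is already above [x]. *)
Lemma bounded_join (X : set (weyl D)) : has_ubound X ->
  exists2 w, supremums X w &
    inversions w `<=` nonneg_span (\bigcup_(x in X) inversions x).
Proof.
move=> [y yX].
pose B w := (forall y', ubound X y' -> (w <= y')%O) /\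
  inversions w `<=` nonneg_span (\bigcup_(x in X) inversions x).
have [|w|w [wmin wcone] max] := @ex_max_length B (len y).
- exists 1%g; split; first by move=> y' _; apply: weak_le1.
  by rewrite inversions1.
- by move=> [wmin _]; apply/weak_leq_length/wmin.
exists w => //; split=> [x Xx|y' /wmin //].
have [j [xj wj jmin jcone]] := pair_join (yX x Xx) (wmin y yX).
suff -> : w = j by [].
apply: weak_le_eq wj _; apply: max; split=> [y' Xy'|e /jcone].
  by apply: jmin; [apply: Xy'|apply: wmin].
apply: nonneg_span_sub => {}e [ex|/wcone //].
by apply: sub_nonneg_span; exists x.
Qed.

(** The join of the lower bounds. *)
Lemma nonempty_meet (Y : set (weyl D)) : Y !=set0 -> exists m, infimums Y m.
Proof.
move=> [y Yy]; have [|m [mub mle] _] := @bounded_join (lbound Y).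
  by exists y => x; apply.
by exists m; split=> // x Yx; apply: mle => z; apply.
Qed.

End Joins.

(** * The relation of preserving an inversion set *)

Lemma finite_inj_image_eq (T : choiceType) (A : set T) (f : T -> T) :
  finite_set A -> injective f -> f @` A `<=` A -> f @` A = A.
Proof.
move=> /finite_fsetP[F ->] fi fF; apply/seteqP; split=> // y yF.
have FE : (f @` F)%fset == F.
  rewrite eqEfcard card_imfset //= leqnn andbT.
  apply/fsubsetP => _ /imfsetP[x xF ->].
  by apply: fF; exists x.
have : y \in (f @` F)%fset by rewrite (eqP FE).
by move=> /imfsetP[x xF ->]; exists x.
Qed.

Section StabRel.
Context (R : realType) (V : lmodType R) (D : simple_system V).
Implicit Types (e a b : V) (u v w x y z : weyl D).

Local Notation simple := (simple_root D).
Local Notation positive := (nonneg_span (simple_root D)).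
Local Notation len := (@weyl_length R V D).

Lemma inversions_finite x : finite_set (inversions x).
Proof.
have [n] := ubnP (len x); elim: n x => // n IHn x; rewrite ltnS => xn.
have [->|/eqP/left_descent[a sa lx]] := eqVneq x 1%g.
  by rewrite inversions1; apply: finite_set0.
have [x' xE] : {x' | x = (simple_refl D a * x')%g}.
  by exists (simple_refl D a * x)%g; rewrite mulgA simple_reflK // mul1g.
apply: (@sub_finite_set _ _ ([set a] `|` refl D a @` inversions x')).
  move=> e ei; have [->|/eqP ea] := eqVneq e a; [by left|right].
  exists (refl D a e); last exact: reflK.
  have [re ep _] := iffLR (inversionsP _ _) ei.
  by move: ei; rewrite xE inversions_simple_mul.
rewrite finite_setU; split; first exact: finite_set1.
apply/finite_image/IHn.
by move: lx; rewrite xE mulgA simple_reflK // mul1g -xE => /leq_trans; apply.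
Qed.

Lemma stab_relP x z : stab_rel x z <->
  (forall e, inversions x e -> inversions x (z e)) /\
  (forall e, inversions x e -> inversions x ((z^-1)%g e)).
Proof.
split=> [xz|[zx zVx]].
  split=> e ei; first by rewrite -xz; exists e.
  by move: ei; rewrite -{1}xz => -[f fi <-]; rewrite weylK.
apply/seteqP; split=> [_ [e ei <-]|e ei]; first exact: zx.
by exists ((z^-1)%g e); [exact: zVx|exact: weylVK].
Qed.

Lemma stab_relV x z : stab_rel x z -> stab_rel x (z^-1)%g.
Proof. by move=> /stab_relP[zx zVx]; apply/stab_relP; rewrite invgK. Qed.

Lemma stab_rel1 x : stab_rel x 1%g.
Proof. by apply/stab_relP; rewrite invg1. Qed.

Lemma stab_relM x y z : stab_rel x y -> stab_rel x z -> stab_rel x (y * z)%g.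
Proof.
move=> /stab_relP[yx yVx] /stab_relP[zx zVx]; apply/stab_relP.
by rewrite invgM; split=> e ei; rewrite weylM; auto.
Qed.

Lemma stab_rel_weak_le x z : stab_rel x z -> (z <= (z * x)%g :> weyl D)%O.
Proof.
move=> /stab_relP[zx _]; apply/weak_le_mulP => e /zx; exact: inversions_positive.
Qed.

Lemma stab_rel_disjoint x z : stab_rel x z -> inversions z `&` inversions x = set0.
Proof.
move=> /stab_relP[_ zVx]; apply/seteqP; split=> // e [/inversions_negative ze /zVx].
by move/inversions_positive.
Qed.

Lemma stab_rel_inversions x z : stab_rel x z ->
  inversions (z * x)%g = inversions z `|` inversions x.
Proof.
move=> xz; have [zx zVx] := iffLR (stab_relP _ _) xz.
have le := stab_rel_weak_le xz.
apply/seteqP; split=> e.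
  move=> /(inversions_mul _ le)[|ei]; [by left|right].
  by rewrite -(weylVK z e); apply: zx.
by move=> ei; apply/(inversions_mul _ le); case: ei => [|/zVx]; [left|right].
Qed.

(** The hypotheses show that [z^-1] maps [inversions x] into itself; as this set is
  finite, the inclusion is an equality. *)
Lemma stab_rel_intro x z : (z <= (z * x)%g :> weyl D)%O ->
  (x <= (z * x)%g :> weyl D)%O ->
  inversions z `&` inversions x = set0 -> stab_rel x z.
Proof.
move=> zzx /weak_leP xzx dis.
have zVx e : inversions x e -> inversions x ((z^-1)%g e).
  move=> ei; have := xzx e ei => /(inversions_mul _ zzx)[ze|//].
  by have : set0 e by rewrite -dis.
have zV : (z^-1)%g @` inversions x = inversions x.
  apply: finite_inj_image_eq; first exact: inversions_finite.
    exact: can_inj (weylVK z).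
  by move=> _ [e ei <-]; apply: zVx.
by rewrite -[z]invgK; apply: stab_relV.
Qed.

Lemma join_of_inversions x z y :
  inversions y = inversions z `|` inversions x -> supremums [set x; z] y.
Proof.
move=> E; split=> [_ [->|->]|y' ub].
- by apply/weak_leP; rewrite E => e; right.
- by apply/weak_leP; rewrite E => e; left.
apply/weak_leP; rewrite E => e [|].
  by move: e; apply/weak_leP/ub; right.
by move: e; apply/weak_leP/ub; left.
Qed.

(** As [z] preserves each [inversions y], left multiplication by [z] carries the
  meet [m] to the meet of the elements [z * y], which is above [m].  The meet of
  the [z * y] is reached through the join [j] of [m] and [z], a lower bound of
  them: [z^-1 * j] is below every [y], hence below [m]. *)
Lemma meet_stab_sub (Y : set (weyl D)) m z : Y !=set0 -> infimums Y m ->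
  (forall y, Y y -> stab_rel y z) ->
  forall e, inversions m e -> inversions m ((z^-1)%g e).
Proof.
move=> [y0 Yy0] [mlb mglb] stab e me.
have zzy y : Y y -> (z <= (z * y)%g :> weyl D)%O.
  by move=> Yy; apply/stab_rel_weak_le/stab.
have mzy y : Y y -> (m <= (z * y)%g :> weyl D)%O.
  move=> Yy; apply: le_trans (mlb y Yy) _; apply/weak_leP.
  by rewrite stab_rel_inversions; [right|apply: stab].
have [j [mj zj jmin _]] := pair_join (mzy _ Yy0) (zzy _ Yy0).
have zk : (z <= (z * (z^-1 * j))%g :> weyl D)%O by rewrite mulVKg.
have km : ((z^-1 * j)%g <= m :> weyl D)%O.
  apply: mglb => y Yy; apply/weak_leP => f fi.
  have : inversions (z * y)%g (z f).
    have /weak_leP := jmin _ (mzy y Yy) (zzy y Yy); apply.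
    by rewrite -(mulVKg z j); apply/(inversions_mul _ zk); right; rewrite weylK.
  move=> /(inversions_mul _ (zzy y Yy)); rewrite weylK => -[/inversions_negative|//].
  by rewrite weylK => []; case; apply: inversions_positive fi.
move/weak_leP: km; apply.
have : inversions j e by move: e me; apply/weak_leP.
rewrite -{1}(mulVKg z j) => /(inversions_mul _ zk)[ze|//].
have ye : inversions y0 e by move: e me {ze}; apply/weak_leP/mlb.
by have : set0 e by rewrite -(stab_rel_disjoint (stab y0 Yy0)).
Qed.

Lemma meet_stab (Y : set (weyl D)) m z : Y !=set0 -> infimums Y m ->
  (forall y, Y y -> stab_rel y z) -> stab_rel m z.
Proof.
move=> Y0 infm stab; apply/stab_relP; split; last exact: meet_stab_sub infm stab.
rewrite -{1}[z]invgK; apply: meet_stab_sub infm _ => // y Yy.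
exact/stab_relV/stab.
Qed.

(** Each [y] in [X] is below [z * x], hence so is the join [x]; and [z^-1] maps
  [inversions x] to positive vectors because it permutes the inversion sets that
  span a cone containing [inversions x]. *)
Lemma join_stab_sub (X : set (weyl D)) x z : supremums X x ->
  inversions x `<=` nonneg_span (\bigcup_(y in X) inversions y) ->
  (forall y, X y -> stab_rel y z) ->
  forall e, inversions x e -> inversions x ((z^-1)%g e).
Proof.
move=> [xub xlub] xcone stab e xe.
have xzx : (x <= (z * x)%g :> weyl D)%O.
  apply: xlub => y Xy; apply/weak_leP => f yf; apply/inversionsP.
  have [rf fp _] := iffLR (inversionsP _ _) yf; split=> //.
  rewrite invgM weylM.
  have yzf : inversions y ((z^-1)%g f) by move/stab_relP: (stab y Xy) => [_]; apply.
  by have /weak_leP/(_ _ yzf)/inversionsP[] := xub y Xy.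
have [re _ _] := iffLR (inversionsP _ _) xe.
apply/inversionsP; split; first exact: root_weyl.
  apply: (weyl_nonneg_span _ (xcone e xe)) => f [y Xy yf].
  move/stab_relP: (stab y Xy) => [_ /(_ f yf)]; exact: inversions_positive.
move/weak_leP: xzx => /(_ e xe)/inversionsP[_ _].
by rewrite invgM weylM.
Qed.

Lemma join_stab (X : set (weyl D)) x z : supremums X x ->
  inversions x `<=` nonneg_span (\bigcup_(y in X) inversions y) ->
  (forall y, X y -> stab_rel y z) -> stab_rel x z.
Proof.
move=> supx xcone stab; apply/stab_relP; split; last exact: join_stab_sub stab.
rewrite -{1}[z]invgK; apply: join_stab_sub supx xcone _ => y Xy.
exact/stab_relV/stab.
Qed.

End StabRel.

Theorem theorem1p9 (R : realType) (V : lmodType R) (D : simple_system V) :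
  [/\
    (* (a) *)
    forall x z : weyl D,
      (stab_rel x z <->
        (supremums [set x; z] (z * x)%g /\
         inversions x `&` inversions z = set0)) /\
      ((supremums [set x; z] (z * x)%g /\
         inversions x `&` inversions z = set0) <->
       (inversions (z * x)%g = inversions z `|` inversions x /\
         inversions z `&` inversions x = set0)),
    (* (b) *)
    forall x z : weyl D, stab_rel x z ->
      stab_rel x z^-1%g /\
      weyl_length (z * x)%g = (weyl_length z + weyl_length x)%N,
    (* (c) *)
    forall G : set (weyl D), W_dagger G -> is_subgroup G,
    (* (d) *)
    forall L : set (weyl D), W_star L ->
      [/\ complete_meet_subsemilattice L, L 1%g
        & forall x, L x -> (1%g <= x :> weyl D)%O]
    & (* (e) *)
    forall L : set (weyl D), W_star L ->
      forall X : set (weyl D), X `<=` L -> has_ubound X ->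
        exists x : weyl D,
          [/\ supremums X x, L x
            & forall y, L y -> ubound X y -> (x <= y)%O]].

Proof.
split.
- move=> x z.
  have i_iii : stab_rel x z -> inversions (z * x)%g = inversions z `|` inversions x /\
      inversions z `&` inversions x = set0.
    by move=> xz; split; [exact: stab_rel_inversions|exact: stab_rel_disjoint].
  have iii_ii : inversions (z * x)%g = inversions z `|` inversions x /\
      inversions z `&` inversions x = set0 ->
      supremums [set x; z] (z * x)%g /\ inversions x `&` inversions z = set0.
    by move=> [E dis]; split; [exact: join_of_inversions|rewrite setIC].
  have ii_i : supremums [set x; z] (z * x)%g /\
      inversions x `&` inversions z = set0 -> stab_rel x z.
    move=> [[ub _]]; rewrite setIC; apply: stab_rel_intro.
      by apply: ub; right.
    by apply: ub; left.
  by split; split; auto.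
- move=> x z xz; split; first exact: stab_relV.
  by rewrite (weak_length (stab_rel_weak_le xz)) mulKg.
- move=> _ [X _ <-]; split=> [x Xx|y z Gy Gz x Xx|y Gy x Xx].
  + exact: stab_rel1.
  + exact: stab_relM (Gy x Xx) (Gz x Xx).
  + exact: stab_relV (Gy x Xx).
- move=> _ [Z _ <-]; split=> [Y Y0 YL|z Zz|x _].
  + have [m infm] := nonempty_meet Y0; exists m => // z Zz.
    by apply: meet_stab infm _ => // y /YL; apply.
  + by rewrite /stab_rel inversions1 image_set0.
  + exact: weak_le1.
- move=> _ [Z _ <-] X XL ubX; have [x supx xcone] := bounded_join ubX.
  exists x; split=> // [z Zz|y _ uby].
    by apply: join_stab supx xcone _ => y /XL; apply.
  by case: supx => _; apply.
Qed.
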